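(* Let $a,c\in\mathbb{N}$ and $b,d\in\mathbb{Z}$ be constants and define \[L:=\left\{\frac{\varphi(an+b)}{\varphi(cn+d)}:\ n\in\mathbb{N},\ n>\max\Big\{-\frac{b}{a},-\frac{d}{c}\Big\}\right\}.\] If $ad\neq bc$, then $L$ is dense in $]0,\infty[$. If $ad=bc$, then $\#L=2^{\omega(\tau_c(a)\,\tau_a(c))}$, where the exponent is the number of primes dividing only one of the numbers $a,c$.
   Context: $\mathbb{N}$ is the set of positive integers, $\varphi$ is Euler's totient function, $]0,\infty[$ is the set of positive real numbers, and $\omega(n)$ is the number of distinct primes dividing $n$. For a prime $p$ and $k\in\mathbb{N}$, $p^k\,\|\,m$ means $p^k\mid m$ and $p^{k+1}\nmid m$. For integers $m\ne 0$ and $n$, put \[\tau_n(m):=\prod_{p^k\| m,\ p\nmid n}p^k,\] the product over the exact prime powers $p^k\,\|\,m$ ($k\ge 1$) with $p\nmid n$. *)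

(* Defs.v *)
From HB Require Import structures.
From mathcomp Require Import all_boot all_order all_algebra.
From mathcomp Require Import all_classical all_reals all_analysis.

Set Implicit Arguments.
Unset Strict Implicit.
Unset Printing Implicit Defensive.

Import Order.TTheory GRing.Theory Num.Theory.
Import numFieldNormedType.Exports.

Local Open Scope classical_set_scope.
Local Open Scope ring_scope.

Definition omega (n : nat) : nat := size (primes n).

(* [logn p m] is the exponent k with p^k || m; for n = 0 every prime divides n
   and the product is empty. *)
Definition tau (n m : int) : nat :=
  (\prod_(p <- primes `|m| | ~~ (p %| `|n|)) p ^ logn p `|m|)%N.

(* The lower bound on n makes a n + b and c n + d positive (for a, c > 0), so
   the absolute value only serves to move from [int] to [nat]. *)
Definition totient_ratios (R : realType) (a c : nat) (b d : int) : set R :=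
  [set x | exists n : nat,
    [/\ (0 < n)%N,
        Num.max (- (b%:~R / a%:R)) (- (d%:~R / c%:R)) < n%:R :> R
      & x = (totient `|a%:Z * n%:Z + b|)%:R / (totient `|c%:Z * n%:Z + d|)%:R]].

Arguments totient_ratios : clear implicits.

(* [topology.dense] is density in the whole space; this is density of A in a
   subset X. *)
Definition dense_in (T : topologicalType) (A X : set T) : Prop :=
  A `<=` X /\ X `<=` closure A.

(* Main.v *)
Require Import Defs.
From HB Require Import structures.
From mathcomp Require Import all_boot all_order all_algebra.
From mathcomp Require Import all_classical all_reals all_analysis.
From mathcomp Require Import zify ring lra.

Import Order.TTheory GRing.Theory Num.Theory.
Import numFieldNormedType.Exports.

Local Open Scope classical_set_scope.
Local Open Scope ring_scope.

(** Write totient m = m * prod_(p | m) (1 - 1/p), so that the ratio in question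
    is (an+b)/(cn+d), which tends to a/c, times a quotient of Euler products.

    Suppose ad <> bc. Put B = a+c+|ad-bc|+1. A prime p >= B divides at most
    one of an+b and cn+d, and it divides a chosen one of them when n lies in a
    suitable class modulo p. Let n be 0 modulo the primes below B, so that these
    contribute a constant; let the primes in [B, w) divide cn+d and those in
    [w, z) divide an+b. Since prod (1 - 1/p) diverges to 0
    ([euler_prod_to0]), w can be chosen so that the contribution is at least the
    target; adding the primes of [w, z) one by one then lowers it in small
    steps, and it stops within a factor 1 - h of the target
    ([tune_small_primes]). There remain the primes from z on, over which
    congruences have no control. But the
    average of sum_(p | m, p >= z) 1/p over many terms m of a progression is
    O(1/z), so for some n both tails are small ([exists_small_tails]).

    Suppose ad = bc. Then a(cn+d) = c(an+b), so a prime dividing neither a nor c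
    divides both or neither of an+b and cn+d and cancels, and a prime dividing
    both a and c contributes a constant. A prime dividing exactly one of a and c
    contributes one of two values that differ by the factor 1 - 1/p, depending on
    whether it divides the sum (a+c)n + (b+d). As a+c is prime to all of these,
    every pattern of divisibility occurs ([active_primes_surj]), and distinct
    patterns give distinct values because the largest prime in a product of
    factors (p-1)/p cannot cancel ([euler_products_inj]). *)

(** * Euler products and the totient *)

(** The part of prod_(p | m) (1 - 1/p) coming from the primes of [lo, hi). Every
    prime divides 0, so m = 0 gives the product over all primes of the range. *)
Definition euler_prod (R : realType) (lo hi m : nat) : R :=
  \prod_(lo <= p < hi | prime p && (p %| m)%N) (1 - p%:R^-1).

Definition recip_sum (R : realType) (lo hi m : nat) : R :=
  \sum_(lo <= p < hi | prime p && (p %| m)%N) p%:R^-1.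

Lemma euler_factor_gt0 (R : realType) (p : nat) : prime p -> 0 < 1 - p%:R^-1 :> R.
Proof. by move=> /prime_gt1 p1; rewrite subr_gt0 invf_lt1 ?ltr1n ?ltr0n ?(ltnW p1). Qed.

Lemma euler_factor_le1 (R : realType) (p : nat) : 1 - p%:R^-1 <= 1 :> R.
Proof. by rewrite gerBl invr_ge0. Qed.

Lemma euler_prod_gt0 (R : realType) (lo hi m : nat) : 0 < euler_prod R lo hi m.
Proof. by apply: prodr_gt0 => p /andP[pp _]; apply: euler_factor_gt0. Qed.

Lemma euler_prod_le1 (R : realType) (lo hi m : nat) : euler_prod R lo hi m <= 1.
Proof.
rewrite /euler_prod big_mkcond; apply: prodr_ile1 => p _.
by case: ifP => [/andP[pp _]|_]; rewrite ?ler01 ?lexx// euler_factor_le1 ltW ?euler_factor_gt0.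
Qed.

Lemma euler_prod_cat (R : realType) (lo mid hi m : nat) :
  (lo <= mid)%N -> (mid <= hi)%N ->
  euler_prod R lo hi m = euler_prod R lo mid m * euler_prod R mid hi m.
Proof. by move=> h1 h2; rewrite /euler_prod (big_cat_nat h1 h2). Qed.

Lemma euler_prod1 (R : realType) (k m : nat) :
  euler_prod R k k.+1 m = if prime k && (k %| m)%N then 1 - k%:R^-1 else 1.
Proof. by rewrite /euler_prod big_mkcond big_nat1. Qed.

Lemma eq_euler_prod (R : realType) (lo hi m n : nat) :
  (forall p, prime p -> (lo <= p < hi)%N -> (p %| m)%N = (p %| n)%N) ->
  euler_prod R lo hi m = euler_prod R lo hi n.
Proof.
move=> h; rewrite /euler_prod big_nat_cond [RHS]big_nat_cond.
apply: eq_bigl => p; case pr: (lo <= p < hi)%N => //=.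
by case pp: (prime p) => //=; rewrite h.
Qed.

Lemma euler_prod_none (R : realType) (lo hi m : nat) :
  (forall p, prime p -> (lo <= p < hi)%N -> ~~ (p %| m)%N) ->
  euler_prod R lo hi m = 1.
Proof.
move=> h; rewrite /euler_prod big_nat_cond big_pred0// => p.
by case pr: (lo <= p < hi)%N => //=; case pp: (prime p) => //=; exact/negbTE/h.
Qed.

Lemma totient_euler_prod (R : realType) (m hi : nat) :
  (0 < m)%N -> (m < hi)%N ->
  (totient m)%:R = m%:R * euler_prod R 0 hi m :> R.
Proof.
move=> m0 mhi.
have -> : euler_prod R 0 hi m = \prod_(p <- primes m) (1 - p%:R^-1).
  rewrite /euler_prod -big_filter; apply: perm_big; apply: uniq_perm.
  - by rewrite filter_uniq ?iota_uniq.
  - exact: primes_uniq.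
  move=> p; rewrite mem_filter mem_index_iota mem_primes m0 /=.
  case: (prime p) => //=; case pm: (p %| m)%N => //=.
  by rewrite (leq_ltn_trans _ mhi)// dvdn_leq.
have mE : m%:R = \prod_(p <- primes m) (p ^ logn p m)%:R :> R.
  by rewrite -natr_prod {1}(prod_prime_decomp m0) prime_decompE big_map.
rewrite totientE// mE natr_prod -big_split/= big_seq [RHS]big_seq.
apply: eq_bigr => p; rewrite mem_primes => /and3P[pp _ pm].
have l0 : (0 < logn p m)%N by rewrite logn_gt0 mem_primes pp m0.
have p0 : p%:R != 0 :> R by rewrite pnatr_eq0 -lt0n prime_gt0.
rewrite -{2}(prednK l0) expnS !natrM [RHS]mulrAC mulrBr mulr1 mulfV//.
by rewrite -[p in p%:R - _](prednK (prime_gt0 pp)) -natr1 addrK.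
Qed.

Lemma recip_sum_ge0 (R : realType) (lo hi m : nat) : 0 <= recip_sum R lo hi m.
Proof. by apply: sumr_ge0 => p _; rewrite invr_ge0. Qed.

(** Each new factor 1 - x lowers a product lying in [0, 1] by at most x. *)
Lemma euler_prod_ge (R : realType) (lo hi m : nat) :
  1 - recip_sum R lo hi m <= euler_prod R lo hi m.
Proof.
suff [] : 0 <= euler_prod R lo hi m <= 1 /\
  1 - recip_sum R lo hi m <= euler_prod R lo hi m by [].
rewrite /recip_sum /euler_prod.
elim/big_rec2 : _ => [|p s q]; first by rewrite subr0 ler01 lexx.
move=> /andP[pp _] [/andP[s0 s1] IH].
have h1 := euler_factor_gt0 R p pp.
have h2 : 0 <= (p%:R^-1 : R) by rewrite invr_ge0.
by split; [apply/andP; split|]; nra.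
Qed.

(** * Divergence of the Euler product over all primes *)

Definition rough (k n : nat) : bool :=
  (0 < n)%N && all (fun p => prime p ==> ~~ (p %| n)%N) (iota 0 k).

Lemma roughP (k n : nat) : reflect
  ((0 < n)%N /\ forall p, prime p -> (p < k)%N -> ~~ (p %| n)%N) (rough k n).
Proof.
apply: (iffP andP) => -[n0 h]; split => //.
  by move=> p pp pk; have /allP/(_ p) := h; rewrite mem_iota pp/=; apply.
by apply/allP => p; rewrite mem_iota/= add0n => pk; apply/implyP => pp; apply: h.
Qed.

(** A k-rough multiple of k is k times a k-rough number. *)
Lemma rough_multiples_le (R : realType) (k N : nat) : (0 < k)%N ->
  \sum_(n < N.+1 | rough k n && (k %| n)%N) (n%:R^-1 : R) <=
  k%:R^-1 * \sum_(n < N.+1 | rough k n) n%:R^-1.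
Proof.
move=> k0.
(* When k * m > N, h m is 0, which is not rough. *)
pose h (m : 'I_N.+1) : 'I_N.+1 := inord (k * m).
pose h' (n : 'I_N.+1) : 'I_N.+1 := inord (n %/ k).
have h'E (n : 'I_N.+1) : h' n = (n %/ k)%N :> nat.
  by rewrite inordK// ltnS (leq_trans (leq_div _ _))// -ltnS.
rewrite (reindex_onto h h')/=; last first.
  move=> i /andP[_ ki]; apply: val_inj => /=.
  by rewrite /h h'E mulnC divnK// inord_val.
rewrite mulr_sumr big_mkcond [leRHS]big_mkcond; apply: ler_sum => m _.
have [kmN|kmN] := ltnP (k * m) N.+1; last first.
  have h0 : h m = 0%N :> nat by rewrite /h /inord /insubd insubF//= ltnNge kmN.
  rewrite h0 /rough ltnn /=.
  by case: ifP => _ //; rewrite mulr_ge0 ?invr_ge0.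
have hE : h m = (k * m)%N :> nat by rewrite inordK.
case: ifP => [/andP[/andP[/roughP[km0 hr] _] _]|_]; last first.
  by case: ifP => _ //; rewrite mulr_ge0 ?invr_ge0.
have -> : rough k m.
  apply/roughP; split; first by move: km0; rewrite hE muln_gt0 => /andP[].
  move=> p pp pk; apply: contra (hr p pp pk); rewrite hE; exact: dvdn_mull.
by rewrite hE natrM invfM.
Qed.

(** The sieve of Eratosthenes applied to the harmonic sum: discarding the
    multiples of a prime k costs at most the fraction 1/k of what is left. *)
Lemma rough_sum_ge (R : realType) (k N : nat) :
  euler_prod R 0 k 0 * \sum_(n < N.+1 | (0 < n)%N) n%:R^-1 <=
  \sum_(n < N.+1 | rough k n) (n%:R^-1 : R).
Proof.
elim: k => [|k IH].
  rewrite /euler_prod big_geq// mul1r le_eqVlt; apply/orP; left; apply/eqP.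
  by apply: eq_bigl => n; rewrite /rough /= andbT.
have [pk|npk] := boolP (prime k); last first.
  have -> : euler_prod R 0 k.+1 0 = euler_prod R 0 k 0.
    by rewrite (euler_prod_cat R 0 k)// euler_prod1 (negbTE npk) mulr1.
  rewrite [leRHS](eq_bigl (fun n : 'I_N.+1 => rough k n))// => n.
  by rewrite /rough -[k.+1]addn1 iotaD all_cat/= (negbTE npk)/= andbT.
have -> : euler_prod R 0 k.+1 0 = euler_prod R 0 k 0 * (1 - k%:R^-1).
  by rewrite (euler_prod_cat R 0 k)// euler_prod1 pk dvdn0.
have := rough_multiples_le R k N (prime_gt0 pk).
have : \sum_(n < N.+1 | rough k n) (n%:R^-1 : R) =
  \sum_(n < N.+1 | rough k n && (k %| n)%N) n%:R^-1 + \sum_(n < N.+1 | rough k.+1 n) n%:R^-1.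
  rewrite (bigID (fun n : 'I_N.+1 => (k %| n)%N))/=; congr (_ + _).
  apply: eq_bigl => n; rewrite /rough -[k.+1]addn1 iotaD all_cat/= pk/= add0n andbT.
  by rewrite andbA.
have := euler_factor_gt0 R k pk.
move: IH; set E := euler_prod _ _ _ _; set S := \sum_(n < _ | rough k n) _.
set H := \sum_(n < _ | (0 < n)%N) _; set T := \sum_(n < _ | _ && _) _.
set U := \sum_(n < _ | rough k.+1 n) _.
by set q := (k%:R^-1 : R); nra.
Qed.

(** Once all primes up to N have been sieved out, only the term n = 1 is left. *)
Lemma euler_prod_harmonic_le1 (R : realType) (N : nat) :
  euler_prod R 0 N.+1 0 * \sum_(n < N.+1 | (0 < n)%N) n%:R^-1 <= 1.
Proof.
apply: (le_trans (rough_sum_ge R N.+1 N)).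
have h (n : 'I_N.+1) : rough N.+1 n -> n = 1%N :> nat.
  move=> /roughP[n0 h]; apply/eqP; rewrite eqn_leq n0 andbT leqNgt; apply/negP => n1.
  have := h (pdiv n) (pdiv_prime n1); rewrite pdiv_dvd => /(_ _)/negP; apply => //.
  by rewrite (leq_ltn_trans (pdiv_leq n0)).
case: N h => [|N] h.
  by rewrite big1 ?ler01// => i /h; case: i => [[]].
rewrite big_mkcond (bigD1 (inord 1))//= big1 ?addr0.
  by case: ifP => _; rewrite ?ler01// inordK// invr1.
move=> i /eqP i1; case: ifP => // /h i1'; exfalso; apply: i1.
by apply: val_inj => /=; rewrite inordK.
Qed.

Lemma harmonic_unbounded (R : realType) (A : R) :
  exists N, A < \sum_(n < N.+1 | (0 < n)%N) n%:R^-1.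
Proof.
apply: contrapT => /forallNP h; apply: (@dvg_harmonic R).
apply: nondecreasing_is_cvgn.
  by apply: nondecreasing_series => n _ _; apply: harmonic_ge0.
exists A => _ [n _ <-]; rewrite leNgt; apply/negP => An; apply: (h n).
rewrite (lt_le_trans An)// /series/= big_mkord [leRHS]big_mkcond [leRHS]big_ord_recl/= add0r.
by apply: ler_sum => i _; rewrite /bump /= add1n.
Qed.

Lemma euler_prod_to0 (R : realType) (lo N : nat) (e : R) : 0 < e ->
  exists z, [/\ (lo <= z)%N, (N <= z)%N & euler_prod R lo z 0 <= e].
Proof.
move=> e0.
have d0 := euler_prod_gt0 R 0 lo 0; set d := euler_prod R 0 lo 0 in d0.
have [M hM] := harmonic_unbounded R (d * e)^-1.
exists (M.+1 + lo + N)%N; split; [lia|lia|].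
have := euler_prod_cat R 0 lo (M.+1 + lo + N) 0 isT ltac:(lia).
have := euler_prod_cat R 0 M.+1 (M.+1 + lo + N) 0 isT ltac:(lia).
have := euler_prod_harmonic_le1 R M.
have := euler_prod_le1 R M.+1 (M.+1 + lo + N) 0.
have := euler_prod_gt0 R M.+1 (M.+1 + lo + N) 0.
have := euler_prod_gt0 R 0 M.+1 0.
move: hM; rewrite -/d.
set S := \sum_(n < _ | _) _.
set x := euler_prod R 0 M.+1 0; set y := euler_prod _ M.+1 _ 0.
set u := euler_prod R lo _ 0; set v := euler_prod R 0 (_ + _ + _)%N 0.
move=> hM x0 y0 y1 xS -> E.
have de0 : 0 < d * e by rewrite mulr_gt0.
have x1 : x <= d * e.
  by rewrite -[d * e]mul1r -ler_pdivrMr// (le_trans _ xS)// ler_wpM2l// ltW.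
by rewrite -(ler_pM2l d0) -E (le_trans _ x1)// ler_piMr// ltW.
Qed.

(** * Large prime factors of the terms of a progression *)

(** Two distinct primes >= K dividing m would give m >= K^2, so the sum has at
    most one term. *)
Lemma recip_sum_large (R : realType) (K hi m : nat) :
  (0 < K)%N -> (0 < m)%N -> (m < K ^ 2)%N -> recip_sum R K hi m <= K%:R^-1.
Proof.
move=> K0 m0 mK.
have [/hasP[p pr /andP[pp pm]]|/hasPn np] :=
  boolP (has (fun p => prime p && (p %| m)%N) (index_iota K hi)); last first.
  by rewrite /recip_sum big_seq_cond big_pred0 ?invr_ge0// => p;
    apply/negbTE/negP => /andP[/np/negP].
move: (pr); rewrite mem_index_iota => /andP[Kp _].
rewrite /recip_sum big_mkcond (bigD1_seq p)/= ?iota_uniq// pp pm/=.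
rewrite big_seq_cond big1 ?addr0.
  by rewrite lef_pV2 ?ler_nat// posrE ltr0n// prime_gt0.
move=> q /andP[]; rewrite mem_index_iota => /andP[Kq _] qp.
case: ifP => // /andP[pq qm]; exfalso.
have cpq : coprime p q by rewrite prime_coprime// dvdn_prime2// eq_sym.
have : (p * q %| m)%N by rewrite Gauss_dvd// pm.
move=> /(dvdn_leq m0); apply/negP; rewrite -ltnNge (leq_trans mK)//.
by rewrite -mulnn leq_mul.
Qed.

(** Each block of p consecutive k contains at most one solution, and there are
    at most K/p + 1 <= 2K/p blocks. *)
Lemma count_progression (K p A D : nat) : (0 < p)%N -> coprime p A ->
  (p <= K)%N ->
  (#|[set k : 'I_K | p %| A * k + D]%SET| * p <= K.*2)%N.
Proof.
move=> p0 cpA pK; set S := [set _ | _]%SET.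
pose f (k : 'I_K) : 'I_(K %/ p).+1 := inord (k %/ p).
have fE k : f k = (k %/ p)%N :> nat.
  by rewrite inordK// ltnS leq_div2r// ltnW.
have finj : {in S &, injective f}.
  have wlg (k l : 'I_K) : k \in S -> l \in S -> (k <= l)%N -> f k = f l -> k = l.
    rewrite !inE => hk hl kl /(congr1 val)/=; rewrite !fE => e.
    have : (p %| l - k)%N.
      rewrite -(Gauss_dvdr _ cpA) mulnBr -(subnDr D) dvdn_sub//.
    move=> plk; apply: val_inj => /=; apply/eqP; rewrite eqn_leq kl/=.
    rewrite -subn_eq0; case: posnP => // lk; have := dvdn_leq lk plk.
    by have := divn_eq k p; have := divn_eq l p; rewrite e;
      have := ltn_pmod k p0; have := ltn_pmod l p0; lia.
  move=> k l hk hl e; have [kl|/ltnW lk] := leqP k l; first exact: wlg.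
  by apply/esym/wlg.
rewrite -(card_in_imset finj).
have := max_card (f @: S); rewrite card_ord => h.
rewrite (leq_trans (leq_mul h (leqnn p)))// mulSn -addnn.
by rewrite leq_add// leq_divM.
Qed.

(** By telescoping, as 1/(p+1)^2 <= 1/p - 1/(p+1). *)
Lemma sum_recip_sq (R : realType) (z K : nat) : (0 < z)%N ->
  \sum_(z.+1 <= p < K) (p%:R^-1 ^+ 2 : R) <= z%:R^-1.
Proof.
move=> z0; have [zK|Kz] := leqP z.+1 K; last by rewrite big_geq ?invr_ge0// ltnW.
suff : \sum_(z.+1 <= p < K) (p%:R^-1 ^+ 2 : R) <= z%:R^-1 - K.-1%:R^-1.
  by move=> /le_trans; apply; rewrite gerBl invr_ge0.
elim: K zK => // K IH; rewrite leq_eqVlt => /predU1P[[<-]|zK].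
  by rewrite big_geq// subrr.
rewrite ltnS in zK; rewrite big_nat_recr//=; have {IH} := IH zK.
move: zK; case: K => // K zK /=.
have K0 : (0 : R) < K%:R by rewrite ltr0n; lia.
have e : (K%:R^-1 - K.+1%:R^-1 = K%:R^-1 * K.+1%:R^-1 :> R).
  by rewrite -natr1; field; lra.
have : K.+1%:R^-1 <= K%:R^-1 :> R by rewrite lef_pV2 ?posrE ?ltr0n ?ler_nat//; lia.
have : 0 < K.+1%:R^-1 :> R by rewrite invr_gt0 ltr0n.
by move: e; set x := K%:R^-1; set y := K.+1%:R^-1; nra.
Qed.

(** Exchanging the summations, a prime p < K contributes 1/p for at most 2K/p
    values of k, hence 2K/p^2 in total. The primes from K on contribute at most 1/K
    for each k, because A k + D < K^2. *)
Lemma recip_sum_total (R : realType) (A D K z hi : nat) :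
  (0 < z)%N -> (0 < D)%N -> (A + D <= K)%N -> (z < K <= hi)%N ->
  (forall p, prime p -> (z < p)%N -> ~~ (p %| A)%N) ->
  \sum_(k < K) recip_sum R z.+1 hi (A * k + D) <= 2 * K%:R / z%:R + 1.
Proof.
move=> z0 D0 ADK /andP[zK Khi] hA.
have K0 : (0 < K)%N by lia.
have split k : recip_sum R z.+1 hi (A * k + D) =
   recip_sum R z.+1 K (A * k + D) + recip_sum R K hi (A * k + D).
  by rewrite /recip_sum (big_cat_nat zK Khi).
rewrite (eq_bigr _ (fun (k : 'I_K) _ => split k)) big_split/= lerD//; last first.
  rewrite (@le_trans _ _ (\sum_(k < K) K%:R^-1))//.
    apply: ler_sum => k _; apply: recip_sum_large => //; first lia.
    by rewrite -mulnn; have := ltn_ord k; nia.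
  by rewrite sumr_const card_ord -[_ *+ K]mulr_natl mulfV// pnatr_eq0; lia.
rewrite /recip_sum.
under eq_bigr do rewrite big_mkcond/=.
rewrite exchange_big/=.
rewrite (@le_trans _ _ (\sum_(z.+1 <= p < K) (2 * K%:R) * (p%:R^-1 ^+ 2)))//; last first.
  by rewrite -mulr_sumr ler_wpM2l ?mulr_ge0 ?sum_recip_sq.
rewrite big_nat_cond [leRHS]big_nat_cond; apply: ler_sum => p /andP[/andP[zp pK] _].
have [pp|np] := boolP (prime p); last first.
  by rewrite big1 ?mulr_ge0// ?exprn_ge0// ?invr_ge0.
rewrite /= -big_mkcond/=.
rewrite (eq_bigl (fun k : 'I_K => k \in [set k : 'I_K | (p %| A * k + D)%N]%SET));
  last first.
  by move=> k; rewrite inE.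
rewrite sumr_const -[_ *+ _]mulr_natr expr2 mulrCA ler_wpM2l ?invr_ge0//.
rewrite ler_pdivlMr ?ltr0n ?prime_gt0// -natrM -natrM ler_nat mul2n.
apply: count_progression; [exact: prime_gt0| |exact: ltnW].
by rewrite prime_coprime// hA.
Qed.

(** The two totals add up to at most 4K/z + 2 < 6K/z, so the average over the K
    values of k is below 6/z. *)
Lemma exists_small_tails (R : realType) (A D A' D' K z hi : nat) :
  (0 < z)%N -> (0 < D)%N -> (0 < D')%N ->
  (forall p, prime p -> (z < p)%N -> ~~ (p %| A)%N) ->
  (forall p, prime p -> (z < p)%N -> ~~ (p %| A')%N) ->
  (A + D <= K)%N -> (A' + D' <= K)%N -> (z < K <= hi)%N ->
  exists2 k : nat, (k < K)%N &
  recip_sum R z.+1 hi (A * k + D) + recip_sum R z.+1 hi (A' * k + D') <= 6 / z%:R.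
Proof.
move=> z0 D0 D0' hA hA' hK hK' zKh.
have := recip_sum_total R A D K z hi z0 D0 hK zKh hA.
have := recip_sum_total R A' D' K z hi z0 D0' hK' zKh hA'.
move=> h1 h2; apply: contrapT => /forall2NP h.
have : \sum_(k < K) (6 / z%:R : R) <=
  \sum_(k < K) (recip_sum R z.+1 hi (A * k + D) + recip_sum R z.+1 hi (A' * k + D')).
  apply: ler_sum => k _; case: (h k) => [|/negP]; first by rewrite ltn_ord.
  by rewrite -ltNge => /ltW.
rewrite big_split/= sumr_const card_ord -[_ *+ K]mulr_natl.
move: h1 h2; set s := \sum_(k < _) _; set t := \sum_(k < _) _ => h1 h2 h3.
have zp : 0 < z%:R :> R by rewrite ltr0n.
have : 1 < K%:R / z%:R :> R by rewrite ltr_pdivlMr// mul1r ltr_nat; case/andP: zKh.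
lra.
Qed.

(** * Congruences and real estimates *)

Lemma linear_congruence (s al : nat) (be : int) (N : nat) :
  (0 < s)%N -> coprime s al ->
  exists2 n : nat, (N <= n)%N & (s %| al%:Z * n%:Z + be)%Z.
Proof.
move=> s0 cop.
have /coprimezP[[u v]/= uv] : coprimez s al by rewrite coprimezE.
pose r := ((- be * v) %% s%:Z)%Z.
have r0 : 0 <= r by apply: modz_ge0; rewrite lt0r_neq0 // ltz_nat.
have rE : r = - be * v - ((- be * v) %/ s%:Z)%Z * s%:Z.
  by apply/eqP; rewrite eq_sym subr_eq addrC; exact/eqP/divz_eq.
exists (`|r| + N * s)%N; first by rewrite (leq_trans (leq_pmulr N s0))// leq_addl.
rewrite PoszD PoszM gez0_abs// rE.
set q := (_ %/ _)%Z.
apply/dvdzP; exists (be * u - al%:Z * q + al%:Z * N%:Z).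
transitivity (al%:Z * (- be * v - q * s + N * s) + be * (u * s + v * al)).
  by rewrite uv mulr1.
by ring.
Qed.

Lemma coprime_by_primes (m n : nat) :
  (0 < m)%N -> (forall p, prime p -> (p %| m)%N -> ~~ (p %| n)%N) -> coprime m n.
Proof.
move=> m0 h; rewrite /coprime eqn_leq gcdn_gt0 m0 andbT leqNgt; apply/negP => g1.
have pp := pdiv_prime g1; have := pdiv_dvd (gcdn m n); rewrite dvdn_gcd => /andP[pm].
exact/negP/h.
Qed.

Definition prime_prod (lo hi : nat) : nat := (\prod_(lo <= p < hi | prime p) p)%N.

Lemma prime_prod_gt0 (lo hi : nat) : (0 < prime_prod lo hi)%N.
Proof. by apply: prodn_cond_gt0 => p; apply: prime_gt0. Qed.

Lemma prime_dvd_prod (I : eqType) (r : seq I) (P : pred I) (f : I -> nat) (p : nat) :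
  prime p -> (forall i, P i -> prime (f i)) ->
  (p %| \prod_(i <- r | P i) f i)%N = has (fun i => P i && (f i == p)) r.
Proof.
move=> pp hf; rewrite Euclid_dvd_prod// big_has_cond; apply: eq_has => i /=.
by case Pi: (P i) => //=; rewrite dvdn_prime2 ?hf// eq_sym.
Qed.

Lemma dvd_prime_prod (lo hi p : nat) : prime p ->
  (p %| prime_prod lo hi)%N = (lo <= p < hi)%N.
Proof.
move=> pp; rewrite prime_dvd_prod// -mem_index_iota.
apply/hasP/idP => [[q qr /andP[_ /eqP<-]]//|pr].
by exists p => //; rewrite pp eqxx.
Qed.

(** The moduli are treated one after the other instead of by a general Chinese
    remainder theorem: n is U (m1 + W m2), where U, W and Z are the products of the
    primes of the three ranges, m1 solves the congruence modulo W and m2 the one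
    modulo Z. *)
Lemma prescribed_residues (a c : nat) (b d : int) (B w z N : nat) :
  (forall p, prime p -> (B <= p)%N -> ~~ (p %| a)%N && ~~ (p %| c)%N) ->
  exists n : nat, [/\ (N <= n)%N,
    (forall p, prime p -> (p < B)%N -> (p %| n)%N),
    (forall p, prime p -> (B <= p < w)%N -> (p %| c%:Z * n%:Z + d)%Z) &
    (forall p, prime p -> (B <= p)%N -> (w <= p < z)%N -> (p %| a%:Z * n%:Z + b)%Z)].
Proof.
move=> hac.
pose U := prime_prod 0 B; pose W := prime_prod B w; pose Z := prime_prod (maxn B w) z.
have Up p : prime p -> (p %| U)%N = (p < B)%N by move=> pp; rewrite dvd_prime_prod.
have Wp p : prime p -> (p %| W)%N = (B <= p < w)%N by move=> pp; rewrite dvd_prime_prod.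
have Zp p : prime p -> (p %| Z)%N = (maxn B w <= p < z)%N by move=> pp; rewrite dvd_prime_prod.
have U0 : (0 < U)%N := prime_prod_gt0 0 B.
have W0 : (0 < W)%N := prime_prod_gt0 B w.
have Z0 : (0 < Z)%N := prime_prod_gt0 (maxn B w) z.
have [m1 _ hm1] : exists2 m : nat, (0 <= m)%N & (W %| (c * U)%N%:Z * m%:Z + d)%Z.
  apply: linear_congruence => //; apply: coprime_by_primes => // p pp.
  rewrite Wp// => /andP[Bp _]; rewrite Euclid_dvdM// Up// ltnNge Bp/= orbF.
  by have /andP[] := hac p pp Bp.
have [m2 hN hm2] : exists2 m : nat, (N <= m)%N &
    (Z %| (a * (U * W))%N%:Z * m%:Z + (a%:Z * U%:Z * m1%:Z + b))%Z.
  apply: linear_congruence => //; apply: coprime_by_primes => // p pp.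
  rewrite Zp// geq_max => /andP[/andP[Bp wp] _].
  rewrite !Euclid_dvdM// Up// Wp// ltnNge Bp/= ltnNge wp/= orbF.
  by have /andP[] := hac p pp Bp.
exists (U * (m1 + W * m2))%N; split.
- rewrite (leq_trans hN)// (leq_trans _ (leq_pmull _ U0))//.
  by rewrite (leq_trans (leq_pmull m2 W0))// leq_addl.
- by move=> p pp pB; rewrite dvdn_mulr// Up.
- move=> p pp pW.
  have -> : c%:Z * (U * (m1 + W * m2))%N%:Z + d =
     ((c * U)%N%:Z * m1%:Z + d) + (c%:Z * U%:Z * m2%:Z) * W%:Z.
    by rewrite !(PoszM, PoszD); ring.
  have pWW : (p%:Z %| W%:Z)%Z by rewrite dvdzE/= Wp.
  by rewrite rpredD// ?(dvdz_trans pWW)// dvdz_mull.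
- move=> p pp Bp /andP[wp pz].
  have -> : a%:Z * (U * (m1 + W * m2))%N%:Z + b =
     (a * (U * W))%N%:Z * m2%:Z + (a%:Z * U%:Z * m1%:Z + b).
    by rewrite !(PoszM, PoszD); ring.
  apply: dvdz_trans hm2.
  by rewrite dvdzE/= Zp// geq_max Bp wp.
Qed.

Lemma close_product (R : realFieldType) (h u g T1 T2 : R) : 0 < h -> h <= 1 / 2 ->
  `|u - 1| <= h -> 1 - h <= g <= 1 -> 1 - h <= T1 <= 1 -> 1 - h <= T2 <= 1 ->
  `|u * g * T1 / T2 - 1| <= 4 * h.
Proof.
move=> h0 h2; rewrite ler_distl => /andP[u1 u2] /andP[g1 g2] /andP[a1 a2] /andP[b1 b2].
have T0 : 0 < T2 by lra.
have gT1 : (1 - h) * (1 - h) <= g * T1 by nra.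
have gT2 : g * T1 <= 1 by nra.
have gT0 : 0 <= g * T1 by nra.
rewrite -(mulrA u g T1); set q := g * T1 in gT1 gT2 gT0 *.
rewrite ler_distl ler_pdivlMr// ler_pdivrMr//; apply/andP; split; nra.
Qed.

Lemma max_boundP (R : realType) (a c : nat) (b d : int) (n : nat) :
  (0 < a)%N -> (0 < c)%N ->
  (Num.max (- (b%:~R / a%:R)) (- (d%:~R / c%:R)) < n%:R :> R) =
  (0 < a%:Z * n%:Z + b) && (0 < c%:Z * n%:Z + d).
Proof.
have h (e : nat) (f : int) : (0 < e)%N ->
    (- (f%:~R / e%:R) < n%:R :> R) = (0 < e%:Z * n%:Z + f).
  move=> e0; rewrite -mulNr ltr_pdivrMr ?ltr0n// -subr_gt0 opprK.
  rewrite -(ltr0z R) rmorphD rmorphM/= mulrC//.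
by move=> a0 c0; rewrite gt_max !h.
Qed.

(** Choose w with c0 / prod_[B,w) >= t, then let z be the first point where the
    extra factors 1 - 1/p, p >= w, bring this quantity down to t or below. The last
    factor is at least 1 - 1/w >= 1 - h, so it does not overshoot by more. *)
Lemma tune_small_primes (R : realType) (c0 t h : R) (B N : nat) :
  0 < c0 -> 0 < t -> 0 < h ->
  exists w z : nat, [/\ (B <= w)%N, (N < w)%N, (w <= z)%N &
    1 - h <= c0 / euler_prod R B w 0 * euler_prod R w z 0 / t <= 1].
Proof.
move=> c00 t0 h0.
have [w [Bw Nw Ew]] := euler_prod_to0 R B (N + Num.bound h^-1).+1 (c0 / t) (divr_gt0 c00 t0).
have Ew0 := euler_prod_gt0 R B w 0.
pose v z : R := c0 / euler_prod R B w 0 * euler_prod R w z 0.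
have v0 z : 0 < v z by rewrite mulr_gt0 ?divr_gt0 ?euler_prod_gt0.
pose P j := v (w + j)%N <= t.
have exP : exists j, P j.
  have [z [wz _ Ez]] := euler_prod_to0 R w 0 (t / (c0 / euler_prod R B w 0))
     (divr_gt0 t0 (divr_gt0 c00 Ew0)).
  exists (z - w)%N; rewrite /P subnKC// /v mulrC -ler_pdivlMr ?divr_gt0//.
have [j Pj minj] := ex_minnP exP.
exists w, (w + j)%N; split => //; [lia|by rewrite leq_addr|].
rewrite -/(v _) ler_pdivrMr// mul1r (Pj : v _ <= t) andbT ler_pdivlMr//.
case: j Pj minj => [|j] Pj minj.
  rewrite addn0 /v /euler_prod (big_geq (leqnn w)) mulr1 -/(euler_prod R B w 0).
  rewrite ler_pdivlMr//; move: Ew; rewrite ler_pdivlMr// => Ew.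
  by have := mulr_gt0 h0 (mulr_gt0 Ew0 t0); nra.
have vj : t < v (w + j)%N.
  by rewrite ltNge; apply/negP => /minj; rewrite ltnn.
have -> : v (w + j.+1)%N = v (w + j)%N * euler_prod R (w + j) (w + j).+1 0.
  by rewrite /v addnS (euler_prod_cat R w (w + j)) ?leq_addr// mulrA.
have hw : (w%:R^-1 : R) <= h.
  rewrite -[h]invrK lef_pV2 ?posrE ?invr_gt0 ?ltr0n//; last lia.
  have hb : h^-1 < (Num.bound h^-1)%:R by apply: archi_boundP; rewrite invr_ge0 ltW.
  by apply: (le_trans (ltW hb)); rewrite ler_nat; lia.
have w1 : ((w + j)%:R^-1 : R) <= w%:R^-1.
  by rewrite lef_pV2 ?posrE ?ltr0n ?ler_nat ?leq_addr//; lia.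
have e1 : 1 - h <= euler_prod R (w + j) (w + j).+1 0.
  by rewrite euler_prod1; case: ifP => _; lra.
have e2 := euler_prod_gt0 R (w + j) (w + j).+1 0.
apply: (le_trans (ler_wpM2r (ltW t0) e1)).
by rewrite [leRHS]mulrC ler_wpM2l ?(ltW e2)// ltW.
Qed.

Lemma shared_prime_dvd_det (a c p : nat) (b d n : int) :
  (p %| a%:Z * n + b)%Z -> (p %| c%:Z * n + d)%Z ->
  (p %| `|(a%:Z * d - b * c%:Z)%R|)%N.
Proof.
move=> h1 h2.
suff : (p %| a%:Z * d - b * c%:Z)%Z by [].
have -> : a%:Z * d - b * c%:Z = a%:Z * (c%:Z * n + d) - c%:Z * (a%:Z * n + b) by ring.
by rewrite rpredB// dvdz_mull.
Qed.

Lemma linear_ratio_near (R : realType) (a c : nat) (b d n : int) (m1 m2 : nat) (h : R) :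
  (0 < a)%N -> (0 < m2)%N -> m1%:Z = a%:Z * n + b -> m2%:Z = c%:Z * n + d ->
  `|(a%:Z * d - b * c%:Z)%R|%N%:R <= h * m2%:R ->
  `|m1%:R / m2%:R * (c%:R / a%:R) - 1| <= h :> R.
Proof.
move=> a0 m20 e1 e2 hh.
have m2p : 0 < m2%:R :> R by rewrite ltr0n.
have ap : 1 <= a%:R :> R by rewrite ler1n.
have ap' : 0 < a%:R :> R by rewrite ltr0n.
have -> : m1%:R / m2%:R * (c%:R / a%:R) - 1 =
    (m1%:R * c%:R - a%:R * m2%:R) / (m2%:R * a%:R) :> R.
  by field; rewrite !gt_eqF.
have -> : m1%:R * c%:R - a%:R * m2%:R = (- (a%:Z * d - b * c%:Z))%:~R :> R.
  have -> : - (a%:Z * d - b * c%:Z) = m1%:Z * c%:Z - a%:Z * m2%:Z by rewrite e1 e2; ring.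
  by rewrite rmorphB !rmorphM.
rewrite normrM normfV -intr_norm normrN (gtr0_norm (mulr_gt0 m2p ap')).
rewrite ler_pdivrMr ?mulr_gt0//.
rewrite -abszE (le_trans hh)// mulrA ler_peMr// mulr_ge0 ?(ltW m2p)//.
have : 0 <= h * m2%:R by apply: le_trans hh; rewrite ler0n.
by rewrite pmulr_lge0.
Qed.

(** * Density when ad and bc differ *)

(** [exists_small_tails] for the values of both linear forms on the class of n0
    modulo M. *)
Lemma small_tails_on_progression (R : realType) (a c : nat) (b d : int) (M n0 z : nat) :
  (0 < a)%N -> (0 < c)%N -> (0 < z)%N -> (`|b| < n0)%N -> (`|d| < n0)%N ->
  (forall p, prime p -> (z < p)%N -> ~~ (p %| a * M)%N) ->
  (forall p, prime p -> (z < p)%N -> ~~ (p %| c * M)%N) ->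
  exists k m1 m2 hi : nat,
    [/\ m1%:Z = a%:Z * (n0 + M * k)%N%:Z + b, m2%:Z = c%:Z * (n0 + M * k)%N%:Z + d,
        [/\ (0 < m1 < hi)%N, (0 < m2 < hi)%N & (z < hi)%N] &
        recip_sum R z.+1 hi m1 + recip_sum R z.+1 hi m2 <= 6 / z%:R].
Proof.
move=> a0 c0 z0 bn dn hA hA'.
have lin (e : nat) (f : int) : (0 < e)%N -> (`|f| < n0)%N ->
  exists2 D : nat, (0 < D)%N & forall k : nat,
    (e * M * k + D)%N%:Z = (e%:Z * (n0 + M * k)%N%:Z + f)%R.
  move=> e0 fn; clear -e0 fn.
  have pos : 0 < e%:Z * n0%:Z + f by nia.
  exists `|(e%:Z * n0%:Z + f)%R|%N; first by rewrite absz_gt0 gt_eqF.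
  by move=> k; rewrite !(PoszD, PoszM) gtz0_abs//; ring.
have [D D0 hD] := lin a b a0 bn.
have [D' D0' hD'] := lin c d c0 dn.
move: (a * M)%N (c * M)%N hA hA' hD hD' => A A' hA hA' hD hD'.
pose K := (A + D + (A' + D') + z).+1.
pose hi := (A * K + D + (A' * K + D') + K)%N.
have KA : (A + D <= K)%N by clear; lia.
have KA' : (A' + D' <= K)%N by clear; lia.
have zKhi : (z < K <= hi)%N by clear; lia.
have [k kK tails] := exists_small_tails R A D A' D' K z hi z0 D0 D0' hA hA' KA KA' zKhi.
exists k, (A * k + D)%N, (A' * k + D')%N, hi; split => //.
have lekK e : (e * k <= e * K)%N by rewrite leq_mul// ltnW.
have K0 : (0 < K)%N by [].
rewrite /hi; clear -D0 D0' lekK K0 zKhi; split.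
- by have := lekK A; lia.
- by have := lekK A'; lia.
- by case/andP: zKhi => zK; apply: leq_trans.
Qed.

(** The ratio is x times four factors close to 1: the ratio of the linear forms
    over a/c, the tuned contribution of the primes below z over its target t, and
    the two tails. *)
Lemma totient_ratio_approx (R : realType) (a c : nat) (b d : int) (x h : R) :
  (0 < a)%N -> (0 < c)%N -> a%:Z * d <> b * c%:Z -> 0 < x -> 0 < h -> h <= 1 / 2 ->
  exists2 v, totient_ratios R a c b d v & `|v / x - 1| <= 4 * h.
Proof.
move=> a0 c0 det x0 h0 h2.
pose Dl := `|(a%:Z * d - b * c%:Z)%R|%N.
have Dl0 : (0 < Dl)%N by rewrite absz_gt0 subr_eq0; apply/eqP.
(* Primes from B on divide neither a, nor c, nor the determinant. *)
pose B := (a + c + Dl).+1.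
have big p m : (0 < m)%N -> (m < B)%N -> (B <= p)%N -> ~~ (p %| m)%N.
  by move=> m0 mB Bp; rewrite gtnNdvd// (leq_trans mB).
have hac p : prime p -> (B <= p)%N -> ~~ (p %| a)%N && ~~ (p %| c)%N.
  by move=> _ Bp; rewrite !big// /B; clear; lia.
pose k0 := euler_prod R 0 B `|b| / euler_prod R 0 B `|d|.
have k00 : 0 < k0 by rewrite divr_gt0 ?euler_prod_gt0.
pose t := x * (c%:R / a%:R).
have t0 : 0 < t by rewrite mulr_gt0// divr_gt0// ltr0n.
pose N0 := Num.bound (6 / h).
have N0h : 6 / h <= N0%:R by rewrite ltW// archi_boundP// divr_ge0// ltW.
have [w [z [Bw Nw wz tuned]]] := tune_small_primes R k0 t h B N0 k00 t0 h0.
case: z wz tuned => [|z'] wz tuned; first by rewrite leqn0 in wz; rewrite (eqP wz) in Nw.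
have zN : (N0 <= z')%N by rewrite -ltnS (leq_trans Nw).
have z'0 : (0 < z')%N.
  by rewrite -ltnS (leq_trans _ wz)// (leq_trans _ Bw)// /B; clear -a0; lia.
pose N1 := Num.bound (Dl%:R / h).
have N1h : Dl%:R / h <= N1%:R by rewrite ltW// archi_boundP// divr_ge0// ltW.
have [n0 [n0N hU hW hZ]] :=
  prescribed_residues a c b d B w z'.+1 (`|b| + `|d| + N1).+1 hac.
pose M := prime_prod 0 z'.+1.
have M0 : (0 < M)%N := prime_prod_gt0 0 z'.+1.
have Mp p : prime p -> (p %| M)%N = (p <= z')%N by move=> pp; rewrite dvd_prime_prod.
have hM e p : (0 < e < B)%N -> prime p -> (z' < p)%N -> ~~ (p %| e * M)%N.
  move=> /andP[e0 eB] pp zp; rewrite Euclid_dvdM// Mp// [(p <= z')%N]leqNgt zp orbF.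
  by apply: big => //; apply: (leq_trans Bw); apply: (leq_trans wz).
have aB : (0 < a < B)%N by rewrite a0 ltnS -addnA leq_addr.
have cB : (0 < c < B)%N by rewrite c0 ltnS addnAC leq_addl.
have [bn dn] : (`|b| < n0)%N /\ (`|d| < n0)%N by clear -n0N; lia.
have [k [m1 [m2 [hi [m1E m2E [/andP[m10 m1hi] /andP[m20 m2hi] zhi] tails]]]]] :=
  small_tails_on_progression R a c b d M n0 z' a0 c0 z'0 bn dn
    (fun p => hM a p aB) (fun p => hM c p cB).
pose n := (n0 + M * k)%N.
rewrite -/n in m1E m2E.
have nmod p (e : nat) (f : int) : prime p -> (p <= z')%N ->
    (p %| e%:Z * n%:Z + f)%Z = (p %| e%:Z * n0%:Z + f)%Z.
  move=> pp pz; have -> : e%:Z * n%:Z + f = e%:Z * n0%:Z + f + (e * k)%N%:Z * M%:Z.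
    by rewrite /n !(PoszD, PoszM); ring.
  by rewrite rpredDr// dvdz_mull// dvdzE/= Mp.
have notboth p : prime p -> (B <= p)%N -> (p %| m1)%N -> (p %| m2)%N -> False.
  move=> pp Bp h1 h2'.
  have h1' : (p %| a%:Z * n%:Z + b)%Z by rewrite -m1E.
  have h2'' : (p %| c%:Z * n%:Z + d)%Z by rewrite -m2E.
  have := shared_prime_dvd_det a c p b d n h1' h2''; apply/negP/big => //.
  by rewrite ltnS leq_addl.
have small p : prime p -> (p < B)%N ->
    (p %| m1)%N = (p %| `|b|)%N /\ (p %| m2)%N = (p %| `|d|)%N.
  move=> pp pB; have pz : (p <= z')%N by rewrite -ltnS (leq_trans pB)// (leq_trans Bw).
  have pn e : (p %| e%:Z * n0%:Z)%Z by rewrite dvdz_mull// dvdzE/= hU.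
  split; [rewrite -[LHS]/(p%:Z %| m1%:Z)%Z m1E|rewrite -[LHS]/(p%:Z %| m2%:Z)%Z m2E];
    by rewrite nmod// rpredDl.
have mid p : prime p -> (B <= p < w)%N -> (p %| m2)%N.
  move=> pp /andP[Bp pw]; suff : (p%:Z %| m2%:Z)%Z by [].
  rewrite m2E nmod//; last by rewrite -ltnS (leq_trans pw).
  by rewrite hW// Bp.
have top p : prime p -> (w <= p < z'.+1)%N -> (p %| m1)%N.
  move=> pp /andP[wp pz]; suff : (p%:Z %| m1%:Z)%Z by []; rewrite m1E nmod//.
  by rewrite hZ// ?wp// (leq_trans Bw).
have whi : (w <= hi)%N := leq_trans wz zhi.
have e1 : euler_prod R 0 hi m1 =
  euler_prod R 0 B `|b| * euler_prod R w z'.+1 0 * euler_prod R z'.+1 hi m1.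
  rewrite (euler_prod_cat R 0 B hi)//; last exact: leq_trans whi.
  rewrite (euler_prod_cat R B w hi)//.
  rewrite (euler_prod_cat R w z'.+1 hi)//.
  rewrite (eq_euler_prod R 0 B m1 `|b|); last by move=> p pp /andP[_ /(small p pp)[]].
  rewrite (euler_prod_none R B w); last first.
    move=> p pp pBw; apply/negP => pm1; apply: (notboth p pp) pm1 (mid p pp pBw).
    by case/andP: pBw.
  rewrite (eq_euler_prod R w z'.+1 m1 0); last by move=> p pp pz; rewrite dvdn0 top.
  by rewrite mul1r mulrA.
have e2 : euler_prod R 0 hi m2 =
  euler_prod R 0 B `|d| * euler_prod R B w 0 * euler_prod R z'.+1 hi m2.
  rewrite (euler_prod_cat R 0 B hi)//; last exact: leq_trans whi.
  rewrite (euler_prod_cat R B w hi)//.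
  rewrite (euler_prod_cat R w z'.+1 hi)//.
  rewrite (eq_euler_prod R 0 B m2 `|d|); last by move=> p pp /andP[_ /(small p pp)[]].
  rewrite (eq_euler_prod R B w m2 0); last by move=> p pp pz; rewrite dvdn0 mid.
  rewrite (euler_prod_none R w z'.+1); last first.
    move=> p pp pwz; apply/negP; apply: (notboth p pp) (top p pp pwz).
    by case/andP: pwz => wp _; apply: leq_trans wp.
  by rewrite mul1r mulrA.
exists ((totient m1)%:R / (totient m2)%:R).
  exists n; split; first by rewrite (leq_trans _ (leq_addr _ _))// (leq_trans _ n0N).
    by rewrite max_boundP// -m1E -m2E !ltz_nat m10.
  by rewrite -m1E -m2E.
have hz : 6 / z'%:R <= h.
  rewrite ler_pdivrMr ?ltr0n// mulrC -ler_pdivrMr// (le_trans N0h)// ler_nat//.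
have tail1 : 1 - h <= euler_prod R z'.+1 hi m1 <= 1.
  rewrite euler_prod_le1 andbT (le_trans _ (euler_prod_ge R z'.+1 hi m1))// lerB//.
  by rewrite (le_trans _ hz)// (le_trans _ tails)// lerDl recip_sum_ge0.
have tail2 : 1 - h <= euler_prod R z'.+1 hi m2 <= 1.
  rewrite euler_prod_le1 andbT (le_trans _ (euler_prod_ge R z'.+1 hi m2))// lerB//.
  by rewrite (le_trans _ hz)// (le_trans _ tails)// lerDr recip_sum_ge0.
have ratio : `|m1%:R / m2%:R * (c%:R / a%:R) - 1| <= h :> R.
  apply: (linear_ratio_near R a c b d n m1 m2 h) => //.
  rewrite -/Dl mulrC -ler_pdivrMr// (le_trans N1h)// ler_nat.
  have := leq_pmull n c0; have := leq_addr (M * k) n0; rewrite -/n.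
  by move: m2E n0N; clear; lia.
have := close_product _ _ _ _ _ _ h0 h2 ratio tuned tail1 tail2.
rewrite (totient_euler_prod R m1 hi)// (totient_euler_prod R m2 hi)// e1 e2.
congr (`|_ - 1| <= _).
rewrite /t /k0.
have := euler_prod_gt0 R 0 B `|d|; have := euler_prod_gt0 R B w 0.
have := euler_prod_gt0 R z'.+1 hi m2.
have : 0 < m2%:R :> R by rewrite ltr0n.
have : 0 < a%:R :> R by rewrite ltr0n.
have : 0 < c%:R :> R by rewrite ltr0n.
by move=> *; field; rewrite !gt_eqF.
Qed.

Lemma dense_totient_ratios (R : realType) (a c : nat) (b d : int) :
  (0 < a)%N -> (0 < c)%N -> a%:Z * d <> b * c%:Z ->
  dense_in (totient_ratios R a c b d) `]0, +oo[.
Proof.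
move=> a0 c0 det; split.
  move=> _ [n [_ nmax ->]]; rewrite /= in_itv/= andbT.
  move: nmax; rewrite max_boundP// => /andP[h1 h2].
  by rewrite divr_gt0// ltr0n totient_gt0 absz_gt0 gt_eqF.
move=> x; rewrite /= in_itv/= andbT => x0.
move=> V /nbhs_ballP[e/= e0 eV].
(* The error bound is 4 h x <= e / 2. *)
pose h := Num.min (1 / 2) (e / (8 * x)).
have h0 : 0 < h by rewrite lt_min !divr_gt0// mulr_gt0.
have h2 : h <= 1 / 2 by rewrite ge_min lexx.
have h8 : h <= e / (8 * x) by rewrite ge_min lexx orbT.
have [v vL vx] := totient_ratio_approx R a c b d x h a0 c0 det x0 h0 h2.
exists v; split => //; apply: eV; rewrite /ball/= distrC.
have -> : v - x = x * (v / x - 1) by field; rewrite gt_eqF.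
rewrite normrM (gtr0_norm x0).
rewrite (le_lt_trans (ler_wpM2l (ltW x0) vx))//.
by move: h8; rewrite ler_pdivlMr ?mulr_gt0//; lra.
Qed.

(** * Independence of the factors 1 - 1/p *)

Lemma prime_ndvd_pred (p q : nat) : prime p -> prime q -> (p <= q)%N -> ~~ (q %| p.-1)%N.
Proof. by move=> pp pq pl; rewrite gtnNdvd//; have := prime_gt1 pp; lia. Qed.

(** Multiply out the denominators: the largest prime q of both sets, say of U,
    divides the right-hand side prod_V (p-1) prod_U p, but it divides no p - 1
    with p <= q and no p of V. *)
Lemma disjoint_euler_products (R : realType) (N : nat) (U V : {set 'I_N}) (q : 'I_N) :
  (forall i, i \in U :|: V -> prime i) -> (U :&: V)%SET = finset.set0 ->
  \prod_(i in U) (1 - i%:R^-1 : R) = \prod_(i in V) (1 - i%:R^-1) ->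
  q \in U -> (forall i, i \in U :|: V -> (i <= q)%N) -> False.
Proof.
move=> pr dis eqp qU qmax.
have pq : prime q by apply: pr; rewrite inE qU.
have key (S : {set 'I_N}) : S \subset U :|: V ->
    \prod_(i in S) (1 - i%:R^-1 : R) * (\prod_(i in S) i)%N%:R = (\prod_(i in S) i.-1)%N%:R.
  move=> SUV; rewrite !natr_prod -big_split/=; apply: eq_bigr => i iS.
  have pi := prime_gt0 (pr i (fintype.subsetP SUV _ iS)).
  have i0 : i%:R != 0 :> R by rewrite pnatr_eq0 -lt0n.
  by rewrite mulrBl mul1r mulVf// -[in LHS](prednK pi) -natr1 addrK.
have eqN : (\prod_(i in U) i.-1 * \prod_(i in V) i = \prod_(i in V) i.-1 * \prod_(i in U) i)%N.
  apply/eqP; rewrite -(eqr_nat R) !natrM -!key ?finset.subsetUl ?finset.subsetUr// eqp.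
  by apply/eqP; ring.
have : (q %| \prod_(i in U) i.-1 * \prod_(i in V) i)%N.
  by rewrite eqN (bigD1 q qU)/= mulnCA dvdn_mulr.
rewrite Euclid_dvdM// !Euclid_dvd_prod// => /orP[].
  rewrite big_has_cond => /hasP[i _ /andP[iU]]; apply/negP.
  by apply: prime_ndvd_pred => //; [apply: pr|apply: qmax]; rewrite inE iU.
rewrite big_has_cond => /hasP[i _ /andP[iV]].
have pi : prime i by apply: pr; rewrite inE iV orbT.
rewrite dvdn_prime2// => /eqP/val_inj qi.
by have := finset.in_set0 q; rewrite -dis inE qU qi iV.
Qed.

Lemma euler_products_inj (R : realType) (N : nat) (U V : {set 'I_N}) :
  (forall i, i \in U -> prime i) -> (forall i, i \in V -> prime i) ->
  \prod_(i in U) (1 - i%:R^-1 : R) = \prod_(i in V) (1 - i%:R^-1) -> U = V.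
Proof.
move=> pU pV e.
have nz (S : {set 'I_N}) : (forall i, i \in S -> prime i) ->
    \prod_(i in S) (1 - i%:R^-1 : R) != 0.
  by move=> pS; rewrite gt_eqF// prodr_gt0// => i /pS; apply: euler_factor_gt0.
(* Cancel the common factors. *)
have e' : \prod_(i in U :\: V) (1 - i%:R^-1 : R) = \prod_(i in V :\: U) (1 - i%:R^-1).
  apply: (@mulfI _ (\prod_(i in U :&: V) (1 - i%:R^-1 : R))).
    by apply: nz => i; rewrite inE => /andP[/pU].
  by rewrite -big_setID e (big_setID U) finset.setIC.
have [/eqP h|/set0Pn[i0 hi0]] := boolP (((U :\: V) :|: (V :\: U))%SET == finset.set0).
  apply/eqP; rewrite finset.eqEsubset -!finset.setD_eq0 -!finset.subset0.
  by rewrite -h finset.subsetUl finset.subsetUr.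
exfalso.
have pr i : i \in ((U :\: V) :|: (V :\: U))%SET -> prime i.
  by rewrite !inE => /orP[/andP[_ /pU]|/andP[_ /pV]].
case: (arg_maxnP (fun i : 'I_N => (i : nat)) hi0) => q hq qmax.
have dis : ((U :\: V) :&: (V :\: U))%SET = finset.set0.
  by apply/finset.setP => i; rewrite !inE; case: (i \in U); case: (i \in V).
have : q \in ((U :\: V) :|: (V :\: U))%SET := hq.
rewrite inE => /orP[] hq'.
  exact: (disjoint_euler_products R N (U :\: V) (V :\: U) q).
apply: (disjoint_euler_products R N (V :\: U) (U :\: V) q) => //.
- by move=> i; rewrite finset.setUC; apply: pr.
- by rewrite finset.setIC.
- by move=> i; rewrite finset.setUC; apply: qmax.
Qed.

(** * Counting the values when ad = bc *)

Definition one_sided (a c p : nat) : bool :=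
  prime p && ((p %| a)%N (+) (p %| c)%N).

Lemma one_sided_dvd (a c p : nat) : one_sided a c p -> (p %| a * c)%N.
Proof.
move=> /andP[_]; case pa: (p %| a)%N => /=; first by rewrite dvdn_mulr.
exact: dvdn_mull.
Qed.

Definition one_sided_set (a c : nat) : {set 'I_(a * c).+1} :=
  [set i : 'I_(a * c).+1 | one_sided a c i]%SET.

Lemma prod_factor_widen (R : realType) (N X : nat) (P : pred nat) :
  (N <= X)%N -> (forall p, P p -> (p < N)%N) ->
  \prod_(0 <= p < N | P p) (1 - p%:R^-1 : R) = \prod_(0 <= p < X | P p) (1 - p%:R^-1).
Proof.
move=> NX hP; rewrite (big_nat_widen _ _ _ _ _ NX); apply: eq_bigl => p.
by apply: andb_idr => /hP.
Qed.

Lemma prod_indicator_balance (R : comNzRingType) (X : nat) (F : nat -> R)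
    (P Q S P' Q' S' : pred nat) :
  (forall p, P p + (Q p + S p) = P' p + (Q' p + S' p))%N ->
  \prod_(0 <= p < X | P p) F p *
    (\prod_(0 <= p < X | Q p) F p * \prod_(0 <= p < X | S p) F p) =
  \prod_(0 <= p < X | P' p) F p *
    (\prod_(0 <= p < X | Q' p) F p * \prod_(0 <= p < X | S' p) F p).
Proof.
move=> h.
have mk (T : pred nat) : \prod_(0 <= p < X | T p) F p = \prod_(0 <= p < X) F p ^+ T p.
  by rewrite big_mkcond; apply: eq_bigr => p _; case: (T p).
rewrite (mk P) (mk Q) (mk S) (mk P') (mk Q') (mk S') -!big_split/=.
by apply: eq_bigr => p _; rewrite -!exprD h.
Qed.

Lemma common_prime_dvd (a p n : nat) (b : int) :
  (p %| a)%N -> (p %| a%:Z * n%:Z + b)%Z = (p %| b)%Z.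
Proof. by move=> pa; rewrite rpredDl// dvdz_mulr. Qed.

(** When ad = bc, these are the one-sided primes whose factor 1 - 1/p occurs, after
    normalization, in the ratio: those dividing a only for which p does not divide
    cn+d, and those dividing c only for which p divides an+b. *)
Definition active_primes (a c : nat) (b d : int) (n : nat) : {set 'I_(a * c).+1} :=
  [set i : 'I_(a * c).+1 | one_sided a c i &&
    (((i : nat)%:Z %| (a + c)%N%:Z * n%:Z + (b + d))%Z == (i %| c)%N)]%SET.

(** The part of the ratio that does not depend on n: the primes common to a and c
    give the products over those dividing b and over those dividing d, and the last
    product normalizes each prime dividing c only to contribute 1 or 1 - 1/p
    instead of 1/(1 - 1/p) or 1. *)
Definition degenerate_const (R : realType) (a c : nat) (b d : int) : R :=
  let common P := \prod_(0 <= p < (a * c).+1 |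
    [&& prime p, (p %| a)%N, (p %| c)%N & P p]) (1 - p%:R^-1) in
  a%:R / c%:R * (common (fun p => (p %| b)%Z) /
    (common (fun p => (p %| d)%Z) *
     \prod_(0 <= p < (a * c).+1 | one_sided a c p && (p %| c)%N) (1 - p%:R^-1))).

(** Both sides are compared prime by prime. If p divides a only, then p divides
    an+b, and it divides cn+d exactly when it divides the sum of the two forms; if p
    divides c only, the roles are exchanged. *)
Lemma degenerate_ratio (R : realType) (a c : nat) (b d : int) (n : nat) :
  (0 < a)%N -> (0 < c)%N -> a%:Z * d = b * c%:Z ->
  0 < a%:Z * n%:Z + b -> 0 < c%:Z * n%:Z + d ->
  (totient `|(a%:Z * n%:Z + b)%R|%N)%:R / (totient `|(c%:Z * n%:Z + d)%R|%N)%:R =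
  degenerate_const R a c b d * \prod_(i in active_primes a c b d n) (1 - i%:R^-1) :> R.
Proof.
move=> a0 c0 det p1 p2.
set m1 := `|(a%:Z * n%:Z + b)%R|%N; set m2 := `|(c%:Z * n%:Z + d)%R|%N.
have m1E : m1%:Z = a%:Z * n%:Z + b by rewrite gtz0_abs.
have m2E : m2%:Z = c%:Z * n%:Z + d by rewrite gtz0_abs.
have m10 : (0 < m1)%N by rewrite absz_gt0 gt_eqF.
have m20 : (0 < m2)%N by rewrite absz_gt0 gt_eqF.
have eqm : (a * m2 = c * m1)%N.
  apply/eqP; rewrite -eqz_nat !PoszM m1E m2E; apply/eqP.
  by rewrite !mulrDr det; ring.
have ac0 : (0 < a * c)%N by rewrite muln_gt0 a0.
pose X := (m1 + m2 + a * c).+1.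
have NX : ((a * c).+1 <= X)%N by rewrite /X ltnS leq_addl.
rewrite (totient_euler_prod R m1 X)//; last by rewrite /X -addnA ltnS leq_addr.
rewrite (totient_euler_prod R m2 X)//; last by rewrite /X addnAC ltnS leq_addl.
have acN p : (p %| a * c)%N -> (p < (a * c).+1)%N by rewrite ltnS => /dvdn_leq; apply.
rewrite /degenerate_const.
set Kb := \prod_(0 <= p < _ | [&& _, _, _ & (_ %| b)%Z]) _.
set Kd := \prod_(0 <= p < _ | [&& _, _, _ & (_ %| d)%Z]) _.
set Kc := \prod_(0 <= p < _ | one_sided _ _ _ && _) _.
set KT := \prod_(i in _) _.
have key : euler_prod R 0 X m1 * (Kd * Kc) = euler_prod R 0 X m2 * (Kb * KT).
  have -> : KT = \prod_(0 <= p < X | one_sided a c p &&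
      ((p%:Z %| (a + c)%N%:Z * n%:Z + (b + d))%Z == (p %| c)%N)) (1 - p%:R^-1).
    rewrite -(prod_factor_widen R (a * c).+1 X)//; last first.
      by move=> p /andP[/one_sided_dvd/acN].
    by rewrite big_mkord; apply: eq_bigl => i; rewrite inE.
  have -> : Kb = \prod_(0 <= p < X |
      [&& prime p, (p %| a)%N, (p %| c)%N & (p %| b)%Z]) (1 - p%:R^-1).
    by apply: prod_factor_widen => // p /and4P[_ pa _ _]; apply/acN/dvdn_mulr.
  have -> : Kd = \prod_(0 <= p < X |
      [&& prime p, (p %| a)%N, (p %| c)%N & (p %| d)%Z]) (1 - p%:R^-1).
    by apply: prod_factor_widen => // p /and4P[_ pa _ _]; apply/acN/dvdn_mulr.
  have -> : Kc = \prod_(0 <= p < X | one_sided a c p && (p %| c)%N) (1 - p%:R^-1).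
    by apply: prod_factor_widen => // p /andP[/one_sided_dvd/acN].
  apply: prod_indicator_balance => p; rewrite /one_sided.
  have [pp|//] := boolP (prime p).
  have hac : (p %| a)%N || (p %| m2)%N = (p %| c)%N || (p %| m1)%N.
    by rewrite -!Euclid_dvdM// eqm.
  have hsum : (p%:Z %| (a + c)%N%:Z * n%:Z + (b + d))%Z = (p %| m1 + m2)%N.
    rewrite -[RHS]/(p%:Z %| (m1 + m2)%N%:Z)%Z !PoszD m1E m2E.
    by congr (_ %| _)%Z; ring.
  rewrite hsum.
  have hb : (p %| a)%N -> (p %| b)%Z = (p %| m1)%N.
    by move=> pa; rewrite -(common_prime_dvd a p n b)// -m1E.
  have hd : (p %| c)%N -> (p %| d)%Z = (p %| m2)%N.
    by move=> pc; rewrite -(common_prime_dvd c p n d)// -m2E.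
  move: hac hb hd.
  case pa: (p %| a)%N; case pc: (p %| c)%N => /= hac hb hd.
  - by rewrite hb// hd// !addn0 addnC.
  - by rewrite dvdn_addr -?hac//; case: (p %| m2)%N.
  - by rewrite dvdn_addl ?hac//; case: (p %| m1)%N.
  - by rewrite hac.
have Kd0 : 0 < Kd by apply: prodr_gt0 => p /andP[pp _]; apply: euler_factor_gt0.
have Kc0 : 0 < Kc by apply: prodr_gt0 => p /andP[/andP[pp _] _]; apply: euler_factor_gt0.
have E20 := euler_prod_gt0 R 0 X m2.
have m2R : 0 < m2%:R :> R by rewrite ltr0n.
have cR : 0 < c%:R :> R by rewrite ltr0n.
have -> : euler_prod R 0 X m1 = euler_prod R 0 X m2 * (Kb * KT) / (Kd * Kc).
  by rewrite -key mulfK// gt_eqF// mulr_gt0.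
have -> : m1%:R = a%:R * m2%:R / c%:R :> R.
  by rewrite -natrM eqm natrM mulrC mulKf// gt_eqF.
by field; rewrite !gt_eqF.
Qed.

(** The modulus s is prime to a + c, so the form (a+c)n + (b+d) can be made
    congruent modulo s to the product of exactly those one-sided primes that are to
    divide it. *)
Lemma active_primes_surj (a c : nat) (b d : int) (T : {set 'I_(a * c).+1}) (N : nat) :
  (0 < a)%N -> (0 < c)%N -> T \subset one_sided_set a c ->
  exists2 n : nat, (N <= n)%N & active_primes a c b d n = T.
Proof.
move=> a0 c0 TD.
pose s := (\prod_(i in one_sided_set a c) i)%N.
pose Z (i : 'I_(a * c).+1) := (i \in one_sided_set a c) && ((i \in T) == (i %| c)%N).
pose tau := (\prod_(i | Z i) i)%N.
have Dpr (i : 'I_(a * c).+1) : i \in one_sided_set a c -> prime i.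
  by rewrite inE => /andP[].
have s0 : (0 < s)%N by apply: prodn_cond_gt0 => i /Dpr/prime_gt0.
have dvd_s p : prime p -> (p %| s)%N -> one_sided a c p.
  move=> pp; rewrite prime_dvd_prod// => /hasP[i _ /andP[]].
  by rewrite inE => hi /eqP<-.
have cop : coprime s (a + c).
  apply: coprime_by_primes => // p pp /(dvd_s p pp)/andP[_].
  case pa: (p %| a)%N => /= pc; first by rewrite dvdn_addr.
  by rewrite dvdn_addl// pa.
have [n Nn hn] := linear_congruence s (a + c) (b + d - tau%:Z) N s0 cop.
exists n => //; apply/finset.setP => i; rewrite inE.
case hi: (one_sided a c i) => /=; last first.
  apply/esym/negbTE/negP => /(fintype.subsetP TD); by rewrite inE hi.
have iD : i \in one_sided_set a c by rewrite inE.
have pi := Dpr i iD.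
have is_ : (i %| s)%N by rewrite /s (bigD1 i)//= dvdn_mulr.
have -> : ((i : nat)%:Z %| (a + c)%N%:Z * n%:Z + (b + d))%Z = (i %| tau)%N.
  have h : ((i : nat)%:Z %| (a + c)%N%:Z * n%:Z + (b + d - tau%:Z))%Z.
    by apply: dvdz_trans hn; rewrite dvdzE.
  rewrite -[RHS]/((i : nat)%:Z %| tau%:Z)%Z.
  have -> : (a + c)%N%:Z * n%:Z + (b + d) =
     (a + c)%N%:Z * n%:Z + (b + d - tau%:Z) + tau%:Z by ring.
  by rewrite rpredDl.
have -> : (i %| tau)%N = Z i.
  rewrite /tau prime_dvd_prod//; last by move=> j /andP[/Dpr].
  apply/hasP/idP => [[j _ /andP[Zj /eqP/val_inj<-]]//|Zi].
  by exists i; rewrite ?mem_index_enum// Zi eqxx.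
by rewrite /Z iD /=; case: (i \in T); case: (i %| c)%N.
Qed.

Lemma card_eq_finpred (T : finType) (A : pred T) : ([set x | x \in A] #= `I_#|A|)%card.
Proof.
have -> : [set x | x \in A] = enum_val (A := A) @` [set: 'I_#|A|].
  apply/seteqP; split => [x xA|_ [i _ <-]]; last exact: enum_valP.
  by exists (enum_rank_in xA x) => //; rewrite enum_rankK_in.
apply: card_eq_trans (card_esym card_II).
by apply: inj_card_eq => i j _ _; apply: enum_val_inj.
Qed.

Lemma degenerate_const_gt0 (R : realType) (a c : nat) (b d : int) :
  (0 < a)%N -> (0 < c)%N -> 0 < degenerate_const R a c b d.
Proof.
move=> a0 c0; rewrite /degenerate_const.
have pos (P : pred nat) : (forall p, P p -> prime p) ->
    0 < \prod_(0 <= p < (a * c).+1 | P p) (1 - p%:R^-1 : R).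
  by move=> hP; apply: prodr_gt0 => p /hP; apply: euler_factor_gt0.
rewrite mulr_gt0 ?divr_gt0 ?mulr_gt0 ?ltr0n//; apply: pos => p; first by case/andP.
  by case/andP.
by case/andP => /andP[].
Qed.

Lemma card_totient_ratios (R : realType) (a c : nat) (b d : int) :
  (0 < a)%N -> (0 < c)%N -> a%:Z * d = b * c%:Z ->
  (totient_ratios R a c b d #= `I_(2 ^ #|one_sided_set a c|))%card.
Proof.
move=> a0 c0 det.
pose F (T : {set 'I_(a * c).+1}) : R :=
  degenerate_const R a c b d * \prod_(i in T) (1 - i%:R^-1).
have -> : totient_ratios R a c b d = F @` [set T | T \in powerset (one_sided_set a c)].
  apply/seteqP; split => [_ [n [_ nmax ->]]|_ [T TD <-]].
    move: nmax; rewrite max_boundP// => /andP[p1 p2].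
    exists (active_primes a c b d n); last by rewrite /F -degenerate_ratio.
    by rewrite /= powersetE; apply/fintype.subsetP => i; rewrite !inE => /andP[].
  rewrite /= powersetE in TD.
  have [n nN nT] := active_primes_surj a c b d T (`|b| + `|d|).+1 a0 c0 TD.
  have p1 : 0 < a%:Z * n%:Z + b by clear -nN a0; nia.
  have p2 : 0 < c%:Z * n%:Z + d by clear -nN c0; nia.
  exists n; split; [by apply: leq_trans nN|by rewrite max_boundP// p1 p2|].
  by rewrite degenerate_ratio// nT.
rewrite -card_powerset; apply: card_eq_trans (card_eq_finpred _ _).
apply: inj_card_eq => U V; rewrite !inE /= !powersetE => US VS.
have pr (S : {set 'I_(a * c).+1}) i : S \subset one_sided_set a c -> i \in S -> prime i.
  by move=> /fintype.subsetP h /h; rewrite inE => /andP[].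
move=> /(mulfI (lt0r_neq0 (degenerate_const_gt0 R a c b d a0 c0))).
by apply: euler_products_inj => i; apply: pr; rewrite ?US ?VS.
Qed.

Lemma prime_dvd_tau (a c p : nat) : (0 < a)%N -> prime p ->
  (p %| tau c a)%N = (p %| a)%N && ~~ (p %| c)%N.
Proof.
move=> a0 pp; rewrite /tau /= Euclid_dvd_prod// big_has_cond.
apply/hasP/andP => [[q]|[pa pc]].
  rewrite mem_primes => /and3P[pq _ qa] /andP[qc].
  by rewrite Euclid_dvdX// dvdn_prime2// => /andP[/eqP-> _].
exists p; first by rewrite mem_primes pp a0.
by rewrite /= pc /= Euclid_dvdX// dvdnn logn_gt0 mem_primes pp a0.
Qed.

Lemma tau_gt0 (n m : int) : (0 < tau n m)%N.
Proof.
rewrite /tau big_seq_cond; apply: prodn_cond_gt0 => p.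
by rewrite mem_primes => /andP[/andP[/prime_gt0 p0 _] _]; rewrite expn_gt0 p0.
Qed.

Lemma omega_tau (a c : nat) : (0 < a)%N -> (0 < c)%N ->
  omega (tau c a * tau a c) =
    size [seq p <- primes (a * c) | (p %| a)%N (+) (p %| c)%N].
Proof.
move=> a0 c0; apply: perm_size; apply: uniq_perm; rewrite ?filter_uniq ?primes_uniq//.
move=> p; rewrite mem_filter !mem_primes !muln_gt0 !tau_gt0 a0 c0 /=.
have [pp|] := boolP (prime p); last by rewrite !andbF.
rewrite !Euclid_dvdM// !prime_dvd_tau//.
by case: (p %| a)%N; case: (p %| c)%N.
Qed.

Lemma card_one_sided_set (a c : nat) : (0 < a)%N -> (0 < c)%N ->
  #|one_sided_set a c| = size [seq p <- primes (a * c) | (p %| a)%N (+) (p %| c)%N].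
Proof.
move=> a0 c0; rewrite cardE -(size_map val).
apply: perm_size; apply: uniq_perm; rewrite ?filter_uniq ?primes_uniq//.
  by rewrite (map_inj_uniq val_inj) enum_uniq.
move=> p; rewrite mem_filter mem_primes muln_gt0 a0 c0 /=.
apply/mapP/and3P => [[i]|[pac pp pd]].
  by rewrite mem_enum inE => iac ->; case/andP: (iac) => -> ->; rewrite one_sided_dvd.
have pN : (p < (a * c).+1)%N by rewrite ltnS dvdn_leq// muln_gt0 a0.
by exists (Ordinal pN) => //; rewrite mem_enum inE /one_sided /= pp.
Qed.

Theorem theorem2 (R : realType) (a c : nat) (b d : int)
    (ha : (0 < a)%N) (hc : (0 < c)%N) :
  (a%:Z * d <> b * c%:Z ->
     dense_in (totient_ratios R a c b d) `]0, +oo[) /\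
  (a%:Z * d = b * c%:Z ->
     (totient_ratios R a c b d #= `I_(2 ^ omega (tau c a * tau a c)))%card /\
     omega (tau c a * tau a c) =
       size [seq p <- primes (a * c) | (p %| a)%N (+) (p %| c)%N]).
Proof.
split=> [det|det]; first exact: dense_totient_ratios.
split; last exact: omega_tau.
by rewrite omega_tau// -card_one_sided_set//; apply: card_totient_ratios.
Qed.
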